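(* For any integer $q\geq 3$ and any $a\in[-1,1]$, $$\dim_{\mathrm{H}}(\mu_{a,q})\ \geq\ 1-\frac{1}{q\log q}\sum_{j=1}^{q-2}\left(1-\frac{\cos\frac{(2j+1)\pi}{q}}{\cos\frac{\pi}{q}}\right)\log\left(1-\frac{\cos\frac{(2j+1)\pi}{q}}{\cos\frac{\pi}{q}}\right).$$
   Context: $\mathbb{T}=\mathbb{R}/\mathbb{Z}$. For a finite non-negative Borel measure $\mu$ on $\mathbb{T}$, the lower Hausdorff dimension is $$\dim_{\mathrm{H}}(\mu)=\inf\{\alpha:\ \text{there exists a Borel set } F \text{ with } \mu(F)\neq 0 \text{ and } \dim_{\mathrm{H}}F\leq\alpha\},$$ where $\dim_{\mathrm H}F$ is the Hausdorff dimension of the set $F$. For $a\in[-1,1]$ and an integer $q\geq3$, $\mu_{a,q}$ is the Riesz product $$\mu_{a,q}=\prod_{k=0}^{\infty}\bigl(1+a\cos(2\pi q^kx)\bigr),$$ i.e. the weak-$*$ limit, as $n\to\infty$, of the measures $\prod_{k=0}^{n}(1+a\cos(2\pi q^kx))\,dx$ on $\mathbb{T}$. *)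

(* Defs.v *)
From HB Require Import structures.
From mathcomp Require Import all_boot all_order all_algebra.
From mathcomp Require Import generic_quotient ring_quotient.
From mathcomp Require Import all_classical all_reals all_analysis.

Set Implicit Arguments.
Unset Strict Implicit.
Unset Printing Implicit Defensive.

Import Order.TTheory GRing.Theory Num.Theory.
Import numFieldNormedType.Exports.

Local Open Scope classical_set_scope.
Local Open Scope ring_scope.

Section hausdorff_dimension.
Context {R : realType} {T : metricType R}.
Implicit Types (A F : set T) (s : R).
Local Open Scope ereal_scope.

(* Meaningful for nonempty [A] only: [diam set0 = -oo]. *)
Definition diam A : \bar R :=
  ereal_sup [set z | exists x y, [/\ A x, A y & z = (mdist x y)%:E]].

(* [diam A] to the power [s], the empty set having weight 0 for every [s]. *)
Definition diam_pow s A : \bar R :=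
  if A == set0 then 0 else poweR (diam A) s.

Definition hausdorff_premeasure s (delta : R) F : \bar R :=
  ereal_inf [set \sum_(0 <= i <oo) diam_pow s (U i) | U in
    [set U : (set T)^nat | F `<=` \bigcup_i U i /\
                           forall i, diam (U i) <= delta%:E]].

Definition hausdorff_measure s F : \bar R :=
  ereal_sup [set hausdorff_premeasure s delta F |
    delta in [set delta : R | (0 < delta)%R]].

Definition hausdorff_dim F : \bar R :=
  ereal_inf [set s%:E | s in
    [set s : R | (0 <= s)%R /\ hausdorff_measure s F = 0]].

End hausdorff_dimension.

Definition int_subgroup (R : realType) : zmodClosed R :=
  GRing.ZmodClosed.clone R (@Num.int_num_subdef R) _.

Definition circle (R : realType) : Type := Quotient.quot (int_subgroup R).

Section circle_metric.
Variable R : realType.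
Local Notation T := (circle R).
Local Open Scope quotient_scope.

HB.instance Definition _ :=
  EqQuotient.copy T (Quotient.quot (int_subgroup R)).
HB.instance Definition _ :=
  GRing.Zmodule.copy T (Quotient.quot (int_subgroup R)).
HB.instance Definition _ := isPointed.Build T 0.

Definition to_circle (x : R) : T := \pi_T x.

Lemma to_circleD x y : to_circle (x + y) = to_circle x + to_circle y.
Proof. exact: (@Quotient.pi_add _ (int_subgroup R)). Qed.

Lemma to_circleN x : to_circle (- x) = - to_circle x.
Proof. exact: (@Quotient.pi_opp _ (int_subgroup R)). Qed.

Lemma to_circle0 : to_circle 0 = 0.
Proof. by rewrite -(subrr (0 : R)) to_circleD to_circleN subrr. Qed.

Lemma to_circleP x y : to_circle x = to_circle y <-> x - y \is a Num.int.
Proof.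
rewrite -[_ \is a _]/(x - y \in int_subgroup R) Quotient.idealrBE.
by split=> [/eqP|/eqP].
Qed.

Lemma to_circle_repr (u : T) : to_circle (repr u) = u.
Proof. exact: reprK. Qed.

(* The norm of [u] is the distance to 0 in the fibre of [u], so that
   [circle_norm (u - v)] is the quotient metric. *)
Definition circle_norm (u : T) : R :=
  inf [set `|t| | t in to_circle @^-1` [set u]].

Let fib u := [set `|t| | t in to_circle @^-1` [set u]].

Let fib_inf u : has_inf (fib u).
Proof.
split; first by exists `|repr u|, (repr u) => //=; exact: to_circle_repr.
by exists 0 => _ [t _ <-].
Qed.

Lemma circle_norm_le x : circle_norm (to_circle x) <= `|x|.
Proof. by apply: ge_inf; [exact: (fib_inf _).2|exists x]. Qed.

Lemma circle_norm_lt u e : circle_norm u < e ->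
  exists2 t, to_circle t = u & `|t| < e.
Proof.
rewrite -subr_gt0 => /inf_adherent /(_ (fib_inf u))[_ [t tu <-]] te.
by exists t => //; move: te; rewrite -/(circle_norm u) addrC subrK.
Qed.

Let circle_norm0 : circle_norm 0 = 0.
Proof.
apply/le_anti/andP; split; last first.
  by apply: lb_le_inf; [exact: (fib_inf 0).1|move=> _ [t _ <-]].
by have := circle_norm_le 0; rewrite to_circle0 normr0.
Qed.

Let circle_norm_eq0 u : circle_norm u = 0 -> u = 0.
Proof.
move=> u0.
have [t tu t2] : exists2 t, to_circle t = u & `|t| < 2^-1.
  by apply: circle_norm_lt; rewrite u0 invr_gt0.
have [t0|t0] := eqVneq t 0.
  by rewrite -tu t0 to_circle0.
have [s su st] : exists2 s, to_circle s = u & `|s| < `|t|.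
  by apply: circle_norm_lt; rewrite u0 normr_gt0.
have /to_circleP ints : to_circle t = to_circle s by rewrite tu su.
have st0 : t - s != 0.
  by apply/eqP => /subr0_eq ts; move: st; rewrite ts ltxx.
have := norm_intr_ge1 ints st0; rewrite leNgt => /negP[].
rewrite (le_lt_trans (ler_normB _ _))// (splitr 1) div1r.
by rewrite ltrD// (lt_trans st).
Qed.

Let circle_normN u : circle_norm (- u) = circle_norm u.
Proof.
rewrite /circle_norm; congr inf; apply/seteqP; split=> _ [t /= tu <-].
- by exists (- t); rewrite ?normrN //= to_circleN tu opprK.
- by exists (- t); rewrite ?normrN //= to_circleN tu.
Qed.

Let circle_normD u v : circle_norm (u + v) <= circle_norm u + circle_norm v.
Proof.
apply/ler_addgt0Pr => e e0.
have [t tu te] : exists2 t, to_circle t = u & `|t| < circle_norm u + e / 2.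
  by apply: circle_norm_lt; rewrite ltrDl divr_gt0.
have [s sv se] : exists2 s, to_circle s = v & `|s| < circle_norm v + e / 2.
  by apply: circle_norm_lt; rewrite ltrDl divr_gt0.
rewrite -tu -sv -to_circleD (le_trans (circle_norm_le _))//.
rewrite (le_trans (ler_normD _ _))//.
rewrite tu sv [in leRHS](splitr e) addrACA.
by apply: lerD; exact: ltW.
Qed.

Definition circle_dist (u v : T) : R := circle_norm (u - v).

Let circle_distxx u : circle_dist u u = 0.
Proof. by rewrite /circle_dist subrr circle_norm0. Qed.

Let circle_dist_eq0 u v : circle_dist u v = 0 -> u = v.
Proof. by move=> /circle_norm_eq0/subr0_eq. Qed.

Let circle_distC u v : circle_dist u v = circle_dist v u.
Proof. by rewrite /circle_dist -circle_normN opprB. Qed.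

Let circle_dist_triangle v u w :
  circle_dist u w <= circle_dist u v + circle_dist v w.
Proof.
by rewrite /circle_dist (le_trans _ (circle_normD _ _))// addrA subrK.
Qed.

HB.instance Definition _ := @isMetric.Build R T circle_dist
  circle_distxx circle_dist_eq0 circle_distC circle_dist_triangle.

HB.instance Definition _ :=
  Measurable.copy T (g_sigma_algebraType (@open T)).

Lemma to_circle_continuous : continuous to_circle.
Proof.
move=> x; apply/cvg_ballP => e e0; near=> y.
rewrite ballEmdist /= /mdist /= /circle_dist -to_circleN -to_circleD.
apply: (le_lt_trans (circle_norm_le _)).
near: y; exact: (@cvgr_dist_lt _ R^o _ (nbhs x) _ id x (@cvg_id _ _)).
Unshelve. all: by end_near. Qed.

Lemma measurable_to_circle : measurable_fun [set: R] to_circle.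
Proof.
apply: measurability; first by [].
move=> _ [U oU <-]; rewrite setTI; apply: measurable_realfun.open_measurable.
by move/continuousP: to_circle_continuous; exact.
Qed.

HB.instance Definition _ := isMeasurableFun.Build _ _ R T to_circle
  measurable_to_circle.

Definition circle_lebesgue : set T -> \bar R :=
  pushforward
    (mrestr lebesgue_measure (measurable_itv `[0 : R, 1[%R)) to_circle.

Let circle_lebesgue0 : circle_lebesgue set0 = 0%E.
Proof. by rewrite /circle_lebesgue /pushforward preimage_set0 measure0. Qed.

Let circle_lebesgue_ge0 A : (0 <= circle_lebesgue A)%E.
Proof. by rewrite /circle_lebesgue /pushforward; apply: measure_ge0. Qed.

Let circle_lebesgue_sigma_additive : semi_sigma_additive circle_lebesgue.
Proof.
have mf := measurable_to_circle.
move=> F mF tF mUF; rewrite /circle_lebesgue /pushforward preimage_bigcup.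
apply: measure_semi_sigma_additive.
- by move=> n; rewrite -[X in measurable X]setTI; exact: mf.
- apply/trivIsetP => /= i j _ _ ij; rewrite -preimage_setI.
  by move/trivIsetP : tF => /(_ _ _ _ _ ij) ->//; rewrite preimage_set0.
- by rewrite -preimage_bigcup -[X in measurable X]setTI; exact: mf.
Qed.

HB.instance Definition _ := isMeasure.Build _ _ _ circle_lebesgue
  circle_lebesgue0 circle_lebesgue_ge0 circle_lebesgue_sigma_additive.

End circle_metric.

Section riesz_products.
Context {R : realType}.
Local Notation T := (circle R).

(* Independent of the chosen representative of [x], see [circle_cosE]. *)
Definition circle_cos (m : nat) (x : T) : R := cos (2 * pi * (m%:R * repr x)).

Lemma circle_cosE m (t : R) :
  circle_cos m (to_circle t) = cos (2 * pi * (m%:R * t)).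
Proof.
have /to_circleP/intrP[k hk] : to_circle (repr (to_circle t)) = to_circle t.
  exact: to_circle_repr.
rewrite /circle_cos -[repr _](subrK t) hk (mulrDr m%:R) (mulrDr (2 * pi))
  [X in cos X]addrC.
have -> : 2 * pi * (m%:R * k%:~R) = (m%:Z * k)%:~R * (pi *+ 2) :> R.
  by rewrite intrM -pmulrn -[pi *+ 2]mulr_natl [RHS]mulrC.
case: (m%:Z * k) => n.
  by rewrite -pmulrn [n%:R * _]mulr_natl (periodicn (@cosD2pi R)).
rewrite NegzE mulrNz mulNr -pmulrn [n.+1%:R * _]mulr_natl.
by rewrite -[LHS](periodicn (@cosD2pi R) n.+1) subrK.
Qed.

Definition riesz_density (a : R) (q n : nat) (x : T) : R :=
  \prod_(0 <= k < n.+1) (1 + a * circle_cos (q ^ k)%N x).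

(* [mu] is the weak-* limit of the measures [riesz_density a q n x dx]; this
   determines the finite Borel measure [mu]. *)
Definition is_riesz_product (a : R) (q : nat) (mu : set T -> \bar R) : Prop :=
  forall f : T -> R, continuous f ->
    (\int[@circle_lebesgue R]_x (f x * riesz_density a q n x)%:E)%E
      @[n --> \oo] --> (\int[mu]_x (f x)%:E)%E.

Definition lower_hausdorff_dim (mu : set T -> \bar R) : \bar R :=
  ereal_inf [set alpha%:E | alpha in [set alpha : R |
    exists F : set T, [/\ measurable F, mu F != 0%E &
                         (hausdorff_dim F <= alpha%:E)%E]]].

End riesz_products.

(* Main.v *)
(** Let [N = q ^ n] and let [P_n] be the product of the first [n] factors of the
density. Since [P_n (x + i / N)], [i < N], is an iterated product along the
[q]-adic tree whose one-step factors are [j |-> 1 + Re (z * expi (2 pi j / q))]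
with [`|z| <= 1], and such vectors are convex combinations of the cyclic shifts
of one extremal vector [c], the discrete averages of [P_n `^ p] are at most
[A ^+ n], where [A] is the average of the [c_j `^ p]. The remaining factors are
[1 / N]-periodic with integral at most 1, so the mass which the Riesz product
gives to a union of arcs of length about [1 / N] is bounded by the averages of
[P_n] over the points of the grids [x + i / N] in that union. There are at most
about [N `^ s] arcs of mass greater than [N `^ (- s)]; combining this count with
the bound on the [p]-th moments and letting [p] decrease to 1, the total mass of
these heavy arcs decays geometrically in [n] as soon as [s] is less than the
claimed dimension. Outside of them, the mass distribution principle shows that a
set of zero [s]-dimensional Hausdorff measure is null. *)
Require Import Defs.
From mathcomp Require Import all_boot all_order all_algebra.
From mathcomp Require Import all_classical all_reals all_analysis.
From mathcomp Require Import measurable_realfun.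
From mathcomp Require Import ring lra zify.

Set Implicit Arguments.
Unset Strict Implicit.
Unset Printing Implicit Defensive.

Import Order.TTheory GRing.Theory Num.Theory.
Import numFieldNormedType.Exports.

Local Open Scope classical_set_scope.
Local Open Scope ring_scope.

(** * Convexity inequalities for real powers and cyclic sums *)

(** Convexity, obtained from [1 + z <= expR z]. By homogeneity only [c = x / y] matters; the
    exponential bound gives [c - 1 <= c * ln c] and a lower bound for the power [p - 1] of [c], and
    the two combine. *)
Lemma powR_tangent (R : realType) (p x y : R) : 1 <= p -> 0 <= x -> 0 <= y ->
  y `^ p + p * y `^ (p - 1) * (x - y) <= x `^ p.
Proof.
move=> p1 x0; have p0 : 0 < p by exact: lt_le_trans p1.
rewrite le_eqVlt => /predU1P[<-|y0].
  rewrite powR0 ?gt_eqF// add0r subr0.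
  have [->|p1'] := eqVneq p 1; first by rewrite subrr powRr0 powRr1// !mul1r.
  by rewrite powR0 ?subr_eq0// mulr0 mul0r powR_ge0.
rewrite -(mulr_powRB1 (ltW y0) p0).
have yp : 0 < y `^ (p - 1) by exact: powR_gt0.
move: x0; rewrite le_eqVlt => /predU1P[<-|x0].
  rewrite (powR0 (lt0r_neq0 p0)) sub0r.
  have : 0 <= (p - 1) * (y * y `^ (p - 1)) by rewrite !mulr_ge0 ?subr_ge0// ltW.
  lra.
have c0 : 0 < x / y by exact: divr_gt0.
have -> : x `^ p = y `^ p * (x / y) `^ p.
  by rewrite -powRM ?(ltW y0) ?(ltW c0)// mulrCA divff ?mulr1// gt_eqF.
rewrite -(mulr_powRB1 (ltW y0) p0) -(mulr_powRB1 (ltW c0) p0).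
have cl : x / y - 1 <= x / y * ln (x / y).
  have := expR_ge1Dx (- ln (x / y)); rewrite expRN lnK ?posrE// => h.
  have := ler_wpM2l (ltW c0) h; rewrite divff ?gt_eqF//; lra.
have e1 : 1 + (p - 1) * ln (x / y) <= (x / y) `^ (p - 1).
  by rewrite /powR gt_eqF// expR_ge1Dx.
have e2 := ler_wpM2l (ltW c0) e1.
have e3 : 0 <= (p - 1) * (x / y * ln (x / y) - (x / y - 1)).
  by rewrite mulr_ge0 ?subr_ge0.
have e4 : 1 + p * (x / y - 1) <= x / y * (x / y) `^ (p - 1) by lra.
have := ler_wpM2l (mulr_ge0 (ltW y0) (ltW yp)) e4.
have -> : y * y `^ (p - 1) * (1 + p * (x / y - 1)) =
  y * y `^ (p - 1) + p * y `^ (p - 1) * (x - y).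
  by field; rewrite gt_eqF.
by [].
Qed.

Lemma powR_jensen3 (R : realType) (p u v w x y z : R) : 1 <= p ->
  0 <= u -> 0 <= v -> 0 <= w -> u + v + w = 1 ->
  0 <= x -> 0 <= y -> 0 <= z ->
  (u * x + v * y + w * z) `^ p <= u * x `^ p + v * y `^ p + w * z `^ p.
Proof.
move=> p1 u0 v0 w0 uvw x0 y0 z0.
have m0 : 0 <= u * x + v * y + w * z by rewrite !addr_ge0// mulr_ge0.
set m := u * x + v * y + w * z in m0 *.
have := ler_wpM2l u0 (powR_tangent p1 x0 m0).
have := ler_wpM2l v0 (powR_tangent p1 y0 m0).
have := ler_wpM2l w0 (powR_tangent p1 z0 m0).
set k := p * m `^ (p - 1) => hw hv hu.
(* The tangents at the barycentre [m] are averaged; their linear parts cancel. *)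
have <- : u * (m `^ p + k * (x - m)) + v * (m `^ p + k * (y - m)) +
  w * (m `^ p + k * (z - m)) = m `^ p.
  transitivity ((u + v + w) * m `^ p + k * (m - (u + v + w) * m)).
    by rewrite /m; ring.
  by rewrite uvw; ring.
lra.
Qed.

(** Only the end term wraps around, so periodicity is asked at the single point [x]. *)
Lemma sum_shift_periodic (R : realType) (f : R -> R) (q : nat) (x h : R) :
  f (x + q%:R * h) = f x ->
  \sum_(0 <= j < q) f (x + h + j%:R * h) = \sum_(0 <= j < q) f (x + j%:R * h).
Proof.
case: q => [|q] fq; first by rewrite !big_nil.
rewrite big_nat_recr//= big_nat_recl//= mul0r addr0 addrC.
congr (_ + _); first by rewrite -fq -natr1; congr f; ring.
by apply: eq_bigr => j _; rewrite -natr1; congr f; ring.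
Qed.

(** * The regular polygon of nonnegative cosine vectors *)

Section polygon.
Context {R : realType} (q : nat) (q3 : (3 <= q)%N).
Local Notation h := (pi / q%:R : R).

Let q0 : 0 < q%:R :> R. Proof. by rewrite ltr0n; exact: leq_trans q3. Qed.

Lemma pi_div_gt0 : 0 < h. Proof. by rewrite divr_gt0// pi_gt0. Qed.

Lemma pi_div_lt : h *+ 2 < pi.
Proof.
have p0 := @pi_gt0 R; rewrite -[X in X < _]mulr_natl mulrA ltr_pdivrMr//.
by rewrite mulrC ltr_pM2l// ltr_nat.
Qed.

Lemma cos_pi_div_gt0 : 0 < cos h.
Proof.
apply: cos_gt0_pihalf; have := pi_div_gt0; have := pi_div_lt.
by have := @pi_gt0 R; lra.
Qed.

(** Multiplied by [2 * sin h], the sum telescopes, and its two end terms differ by a full turn. *)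
Lemma sum_cos_shift (x : R) :
  \sum_(0 <= j < q) cos (x + j%:R * (h *+ 2)) = 0.
Proof.
have h0 := pi_div_gt0; have h1 := pi_div_lt.
have s0 : 0 < sin h by apply: sin_gt0_pi; lra.
apply: (@mulfI _ (2 * sin h)); first by rewrite gt_eqF// mulr_gt0.
rewrite mulr0 big_distrr/=.
under eq_bigr => j _.
  rewrite (_ : 2 * _ * _ = sin (x - h + j.+1%:R * (h *+ 2))
    - sin (x - h + j%:R * (h *+ 2))); last first.
    have -> : x - h + j.+1%:R * (h *+ 2) = (x + j%:R * (h *+ 2)) + h.
      by rewrite -natr1; ring.
    have -> : x - h + j%:R * (h *+ 2) = (x + j%:R * (h *+ 2)) - h by ring.
    by rewrite sinD sinB; ring.
  over.
rewrite telescope_sumr//= mul0r addr0.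
have -> : q%:R * (h *+ 2) = pi *+ 2 :> R by field; rewrite gt_eqF.
by rewrite sinD2pi subrr.
Qed.

(** The amplitude [1 / cos h] is the largest one that keeps the samples at [h + j * 2h] nonnegative,
    since [cos h] is the maximum of the cosine there. *)
Definition vertex_coord (x : R) : R := 1 - cos x / cos h.

Definition vertex_coeff (j : nat) : R :=
  vertex_coord ((2 * j + 1)%N%:R * pi / q%:R).

Lemma vertex_coeffE j : vertex_coeff j = vertex_coord (h + j%:R * (h *+ 2)).
Proof. by rewrite /vertex_coeff natrD natrM; congr vertex_coord; ring. Qed.

Lemma vertex_coeff0 : vertex_coeff 0 = 0.
Proof.
rewrite vertex_coeffE mul0r addr0 /vertex_coord divff ?subrr//.
by rewrite gt_eqF// cos_pi_div_gt0.
Qed.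

Let cos_reflect (x : R) : cos (pi *+ 2 - x) = cos x.
Proof. by rewrite addrC cosD2pi cosN. Qed.

Lemma vertex_coeff_last : vertex_coeff q.-1 = 0.
Proof.
rewrite vertex_coeffE /vertex_coord.
have -> : h + q.-1%:R * (h *+ 2) = pi *+ 2 - h.
  rewrite -subn1 natrB; last exact: leq_trans q3.
  by field; rewrite gt_eqF.
by rewrite cos_reflect divff ?subrr// gt_eqF// cos_pi_div_gt0.
Qed.

Lemma vertex_coeff_gt0 j : (1 <= j < q.-1)%N -> 0 < vertex_coeff j.
Proof.
move=> /andP[j1 jq]; rewrite vertex_coeffE /vertex_coord subr_gt0.
rewrite ltr_pdivrMr ?cos_pi_div_gt0// mul1r.
have h0 := pi_div_gt0; have h1 := pi_div_lt.
have qh : q%:R * h = pi by field; rewrite gt_eqF.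
have j1' : 1 <= j%:R :> R by rewrite ler1n.
have jq' : j%:R + 2 <= q%:R :> R.
  by rewrite -[2]/(2%:R) -natrD ler_nat; lia.
have e1 := ler_wpM2r (ltW h0) j1'; have e2 := ler_wpM2r (ltW h0) jq'.
(* Angles beyond [pi] are reflected back to the interval where [cos] decreases. *)
have [le|gt] := lerP (h + j%:R * (h *+ 2)) pi.
  by rewrite ltr_cos ?in_itv/=; lra.
by rewrite -(cos_reflect (h + _)) ltr_cos ?in_itv/=; lra.
Qed.

Lemma vertex_coeff_ge0 j : (j < q)%N -> 0 <= vertex_coeff j.
Proof.
case: j => [|j] jq; first by rewrite vertex_coeff0.
have [->|ne] := eqVneq j.+1 q.-1; first by rewrite vertex_coeff_last.
by apply: ltW; apply: vertex_coeff_gt0; lia.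
Qed.

(** The first and last coefficients vanish, whence the range of summation from 1 to [q - 2] in the
    final bound. *)
Lemma sum_vertex (F : R -> R) : F 0 = 0 ->
  \sum_(0 <= j < q) F (vertex_coeff j) =
  \sum_(1 <= j < q.-1) F (vertex_coeff j).
Proof.
move=> F0; have -> : q = q.-1.+1 :> nat by lia.
rewrite big_nat_recr//= vertex_coeff_last F0 addr0.
by rewrite big_ltn ?vertex_coeff0 ?F0 ?add0r//; lia.
Qed.

Lemma sum_vertex_coeff : \sum_(0 <= j < q) vertex_coeff j = q%:R.
Proof.
under eq_bigr do rewrite vertex_coeffE.
rewrite /vertex_coord sumrB -mulr_suml sum_cos_shift mul0r subr0.
by rewrite big_const_nat subn0 iter_addr addr0.
Qed.

(** The coefficients have mean 1, so the tangent at 1 suffices. This says that the constant vector 1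
    costs no more than a vertex in the convex combinations below. *)
Lemma sum_powR_vertex_ge p : 1 <= p ->
  q%:R <= \sum_(1 <= j < q.-1) vertex_coeff j `^ p.
Proof.
move=> p1; rewrite -(@sum_vertex (fun x => x `^ p)); last first.
  by rewrite powR0// gt_eqF// (lt_le_trans _ p1).
have -> : q%:R = \sum_(0 <= j < q) (1 + p * (vertex_coeff j - 1)).
  rewrite big_split/= -big_distrr/= sumrB sum_vertex_coeff.
  by rewrite big_const_nat subn0 iter_addr addr0 subrr mulr0 addr0.
apply: ler_sum_nat => j /andP[_ jq].
have := powR_tangent p1 (vertex_coeff_ge0 jq) ler01.
by rewrite !powR1 mulr1.
Qed.

(* The vectors [j |-> 1 + Re (z * expi (2 pi j / q))] with nonnegative entries
   form a regular [q]-gon, containing the unit disc, whose vertices are the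
   cyclic shifts of [vertex_coeff]: in the sector between two adjacent vertices
   such a vector is a convex combination of them and of the constant 1. *)
Lemma sum_powR_cos_sector (p a t : R) : 1 <= p -> 0 <= a <= 1 -> - h <= t <= h ->
  \sum_(0 <= j < q) (1 - a * cos (t + j%:R * (h *+ 2))) `^ p <=
  \sum_(1 <= j < q.-1) vertex_coeff j `^ p.
Proof.
move=> p1 /andP[a0 a1] /andP[t0 t1].
have h0 := pi_div_gt0; have h1 := pi_div_lt; have c0 := cos_pi_div_gt0.
have s0 : 0 < sin h by apply: sin_gt0_pi; lra.
have p0 : p != 0 by rewrite gt_eqF// (lt_le_trans _ p1).
(* The weights of the vertices at angles [- h] and [h], found by solving [a * cos (t + x) = (u * cos
   (x - h) + v * cos (x + h)) / cos h] for all [x]. *)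
pose u := a * sin (h - t) / (2 * sin h); pose v := a * sin (t + h) / (2 * sin h).
have u0 : 0 <= u.
  rewrite /u divr_ge0 ?mulr_ge0//; first by apply: sin_ge0_pi; lra.
  by rewrite ltW.
have v0 : 0 <= v.
  rewrite /v divr_ge0 ?mulr_ge0//; first by apply: sin_ge0_pi; lra.
  by rewrite ltW.
have uv : u + v = a * cos t.
  by rewrite /u /v sinB sinD; field; rewrite gt_eqF.
have uv1 : u + v <= 1.
  by rewrite uv; have := ler_wpM2l a0 (cos_le1 t); lra.
have S1 := @sum_vertex (fun x => x `^ p) (powR0 p0).
have S2 : \sum_(0 <= j < q) vertex_coord (- h + j%:R * (h *+ 2)) `^ p =
          \sum_(1 <= j < q.-1) vertex_coeff j `^ p.
  rewrite -S1 -(@sum_shift_periodic _ (fun x => vertex_coord x `^ p)).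
    apply: eq_bigr => j _; rewrite vertex_coeffE.
    by congr (vertex_coord _ `^ _); ring.
  rewrite /vertex_coord; congr ((1 - _ / _) `^ _).
  by rewrite -[RHS]cosD2pi; congr cos; field; rewrite gt_eqF.
apply: (@le_trans _ _ (\sum_(0 <= j < q)
    (u * vertex_coord (- h + j%:R * (h *+ 2)) `^ p + v * vertex_coeff j `^ p
     + (1 - u - v)))).
  apply: ler_sum_nat => j /andP[_ jq].
  have ge j' : (j' < q)%N -> 0 <= vertex_coord (- h + j'%:R * (h *+ 2)).
    case: j' => [|j'] jq'.
      rewrite mul0r addr0 /vertex_coord cosN divff ?subrr//.
      by rewrite gt_eqF// cos_pi_div_gt0.
    have := vertex_coeff_ge0 (ltnW jq'); rewrite vertex_coeffE.
    by rewrite -natr1; congr (0 <= vertex_coord _); ring.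
  have -> : 1 - a * cos (t + j%:R * (h *+ 2)) =
      u * vertex_coord (- h + j%:R * (h *+ 2)) + v * vertex_coeff j
      + (1 - u - v) * 1.
    rewrite vertex_coeffE /vertex_coord /u /v.
    set x := j%:R * _; rewrite sinB sinD !cosD cosN sinN.
    by field; rewrite !gt_eqF.
  apply: le_trans
    (powR_jensen3 p1 u0 v0 _ _ (ge _ jq) (vertex_coeff_ge0 jq) ler01) _.
  - by lra.
  - by lra.
  - by rewrite powR1 mulr1.
rewrite 2!big_split/= -!big_distrr/= S2 S1.
rewrite big_const_nat subn0 iter_addr addr0 -mulr_natr.
have := sum_powR_vertex_ge p1; set S := \sum_(_ <= _ < _) _ => qS.
have := @ler_wpM2l _ (1 - u - v) _ _ _ qS.
by rewrite subr_ge0; lra.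
Qed.

(** Reduction to one sector: moving [t] by [pi] changes the sign of [a], and moving it by multiples
    of [2h] permutes the summands cyclically, so [t] can be brought into [[-h, h]]. *)
Lemma sum_powR_cos_le (p a t : R) : 1 <= p -> -1 <= a <= 1 ->
  \sum_(0 <= j < q) (1 + a * cos (t + j%:R * (h *+ 2))) `^ p <=
  \sum_(1 <= j < q.-1) vertex_coeff j `^ p.
Proof.
move=> p1 a1; have h0 := pi_div_gt0.
wlog a0 : a t a1 / a <= 0.
  move=> H; have [/H//|a0] := leP a 0; first exact.
  under eq_bigr => j _.
    rewrite (_ : a * _ = - a * cos (t + pi + j%:R * (h *+ 2))); last first.
      by rewrite addrAC cosDpi mulrNN.
    over.
  by apply: H; lra.
pose S t := \sum_(0 <= j < q) (1 + a * cos (t + j%:R * (h *+ 2))) `^ p.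
have Sper x : S (x + h *+ 2) = S x.
  rewrite /S (@sum_shift_periodic _ (fun x => (1 + a * cos x) `^ p))//.
  congr ((1 + _ * _) `^ _).
  by rewrite -[RHS]cosD2pi; congr cos; field; rewrite gt_eqF.
have SperZ k x : S (x + k%:~R * (h *+ 2)) = S x.
  case: k => n; first by rewrite -pmulrn mulr_natl (periodicn Sper).
  rewrite NegzE mulrNz mulNr -pmulrn mulr_natl.
  by rewrite -[LHS](periodicn Sper n.+1) subrK.
pose k := Num.floor ((t + h) / (h *+ 2)).
have hh : 0 < h *+ 2 by rewrite mulrn_wgt0.
have k1 : k%:~R * (h *+ 2) <= t + h by rewrite -ler_pdivlMr// floor_le.
have k2 : t + h < (k%:~R + 1) * (h *+ 2).
  by rewrite -ltr_pdivrMr// -[1]/(1%:~R) -intrD floorD1_gt.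
rewrite -/(S t) -(SperZ (- k)) mulrNz mulNr.
have := @sum_powR_cos_sector p (- a) (t - k%:~R * (h *+ 2)) p1.
rewrite /S; under eq_bigr do rewrite mulNr opprK.
by apply; lra.
Qed.

Lemma sum_affine_cos (a t : R) :
  \sum_(0 <= j < q) (1 + a * cos (t + j%:R * (h *+ 2))) = q%:R.
Proof.
rewrite big_split/= -big_distrr/= sum_cos_shift mulr0 addr0.
by rewrite big_const_nat subn0 iter_addr addr0.
Qed.

End polygon.

(** * Choice of the exponent [p] close to 1 *)

(** Inverting [1 - y <= expR (- y)] gives [expR y <= 1 / (1 - y)], which the quadratic dominates in
    this range. *)
Lemma expR_le_quad (R : realType) (y : R) : `|y| <= 2^-1 ->
  expR y <= 1 + y + 2 * y ^+ 2.
Proof.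
rewrite ler_norml => /andP[y0 y1].
have y1' : 0 < 1 - y by lra.
have h1 : 1 - y <= (expR y)^-1 by rewrite -expRN expR_ge1Dx.
have e0 := expR_gt0 y.
have h2 : (1 - y) * expR y <= 1.
  by have := ler_wpM2r (ltW e0) h1; rewrite mulVf ?gt_eqF.
rewrite -(ler_pM2l y1'); apply: (le_trans h2).
have -> : (1 - y) * (1 + y + 2 * y ^+ 2) = 1 + y ^+ 2 * (1 - 2 * y) by ring.
by rewrite lerDl mulr_ge0 ?sqr_ge0//; lra.
Qed.

(* The derivative at [p = 1] of [p |-> \sum_j c_j `^ p / \sum_j c_j] is
   [\sum_j c_j * ln c_j / \sum_j c_j]. *)
Lemma exists_power_sum_lt (R : realType) (m n : nat) (c : nat -> R) (Q t : R) :
  (forall j, (m <= j < n)%N -> 0 < c j) ->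
  \sum_(m <= j < n) c j = Q -> 0 < Q ->
  \sum_(m <= j < n) c j * ln (c j) < t * Q ->
  exists2 p, 1 < p & \sum_(m <= j < n) c j `^ p < Q * expR (t * (p - 1)).
Proof.
move=> c0 cQ Q0 clt.
(* Centring the logarithms at [t] lets the factor [expR (t * e)] come out of every term; the
   first-order coefficient of what remains is [- k < 0]. *)
pose y j := ln (c j) - t.
pose L := 1 + \sum_(m <= j < n) `|y j|.
have L1 : 1 <= L by rewrite lerDl sumr_ge0.
have yL j : (m <= j < n)%N -> `|y j| <= L.
  move=> jmn; rewrite /L (bigD1_seq j) ?mem_index_iota ?iota_uniq//=.
  have : 0 <= \sum_(m <= i < n | i != j) `|y i| by rewrite sumr_ge0.
  by lra.
pose k := t * Q - \sum_(m <= j < n) c j * ln (c j).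
have k0 : 0 < k by rewrite subr_gt0.
have ck : \sum_(m <= j < n) c j * y j = - k.
  by under eq_bigr do rewrite mulrBr; rewrite sumrB -mulr_suml cQ /k; ring.
(* The first bound keeps every [e * y j] within 1/2, as [expR_le_quad] requires; the second makes
   the quadratic error at most half of the linear gain [e * k]. *)
pose e := Num.min (2 * L)^-1 (k / (4 * L ^+ 2 * Q)).
have L0 : 0 < L by lra.
have LQ0 : 0 < 4 * L ^+ 2 * Q by rewrite !mulr_gt0// exprn_gt0.
have e0 : 0 < e by rewrite lt_min invr_gt0 mulr_gt0//= divr_gt0.
have e1 : e * (2 * L) <= 1.
  by rewrite -ler_pdivlMr ?mulr_gt0// mul1r /e ge_min lexx.
have e2 : e * (4 * L ^+ 2 * Q) <= k.
  by rewrite -ler_pdivlMr// /e ge_min lexx orbT.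
exists (1 + e); first lra.
have -> : 1 + e - 1 = e by ring.
apply: (@le_lt_trans _ _
    ((Q + e * (- k) + 2 * e ^+ 2 * L ^+ 2 * Q) * expR (t * e))).
  rewrite -ck -cQ !big_distrr/= -!big_split/= big_distrl/=.
  apply: ler_sum_nat => j jmn; have cj := c0 j jmn.
  rewrite /powR gt_eqF// (_ : (1 + e) * ln (c j) = ln (c j) + e * y j + t * e).
    rewrite !expRD lnK ?posrE// ler_wpM2r ?expR_ge0//.
    have -> : c j + e * (c j * y j) + 2 * e ^+ 2 * L ^+ 2 * c j =
              c j * (1 + e * y j + 2 * (e ^+ 2 * L ^+ 2)) by ring.
    apply: ler_wpM2l; first exact: ltW.
    have eyL : `|e * y j| <= e * L.
      by rewrite normrM (gtr0_norm e0) ler_wpM2l ?yL// ltW.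
    have ey : `|e * y j| <= 2^-1 by apply: (le_trans eyL); lra.
    rewrite (le_trans (expR_le_quad ey))// lerD2l ler_wpM2l//.
    by rewrite -exprMn -(real_normK (num_real _)) lerXn2r ?nnegrE// mulr_ge0 ?ltW.
  by rewrite /y; ring.
rewrite ltr_pM2r ?expR_gt0//.
have := ler_wpM2l (ltW e0) e2; have := mulr_gt0 e0 k0.
have -> : e * (e * (4 * L ^+ 2 * Q)) = 2 * (2 * e ^+ 2 * L ^+ 2 * Q) by ring.
lra.
Qed.

Lemma sum_nat_mul (V : nmodType) (a b : nat) (F : nat -> V) :
  \sum_(0 <= i < a * b) F i =
  \sum_(0 <= i < a) \sum_(0 <= j < b) F (i * b + j)%N.
Proof.
rewrite big_nat_mul; apply: eq_bigr => i _.
rewrite -{1}[(i * b)%N]add0n big_addn mulSn addnK.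
by apply: eq_bigr => j _; rewrite addnC.
Qed.

(** * Riesz products along the [q]-adic grids *)

Section grid.
Context {R : realType} (q : nat) (q0 : (0 < q)%N) (a : R) (a1 : -1 <= a <= 1).
Local Notation T := (circle R).

Definition grid n i : T := to_circle (i%:R / (q ^ n)%N%:R).

Definition riesz_factor k (x : T) : R := 1 + a * circle_cos (q ^ k)%N x.

Definition riesz_prod m n (x : T) : R := \prod_(m <= k < n) riesz_factor k x.

Lemma riesz_densityE n : riesz_density a q n = riesz_prod 0 n.+1.
Proof. by []. Qed.

Lemma riesz_factor_ge0 k x : 0 <= riesz_factor k x.
Proof.
have : `|a * circle_cos (q ^ k) x| <= 1.
  rewrite normrM -[1]mulr1 ler_pM//; first by rewrite ler_norml.
  exact: cos_max.
by rewrite ler_norml /riesz_factor; lra.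
Qed.

Lemma riesz_prod_ge0 m n x : 0 <= riesz_prod m n x.
Proof. by apply: prodr_ge0 => k _; exact: riesz_factor_ge0. Qed.

Let qn_neq0 n : (q ^ n)%N%:R != 0 :> R.
Proof. by rewrite pnatr_eq0 -lt0n expn_gt0 q0. Qed.

Lemma gridS n i j : grid n.+1 (i * q + j) = grid n.+1 j + grid n i.
Proof.
rewrite /grid -to_circleD natrD natrM expnSr natrM; congr to_circle.
by field; rewrite qn_neq0 pnatr_eq0 -lt0n.
Qed.

Lemma circle_cos_periodic m (x : T) (c : R) : m%:R * c \is a Num.int ->
  circle_cos m (x + to_circle c) = circle_cos m x.
Proof.
move=> /intrP[k ck]; rewrite -[x]to_circle_repr -to_circleD !circle_cosE.
rewrite (mulrDr m%:R) ck (mulrDr (2 * pi)).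
have -> : 2 * pi * k%:~R = k%:~R * (pi *+ 2) :> R by ring.
case: k {ck} => n.
  by rewrite -pmulrn (mulr_natl (pi *+ 2)) (periodicn (@cosD2pi R)).
rewrite NegzE mulrNz mulNr -pmulrn (mulr_natl (pi *+ 2)).
by rewrite -[LHS](periodicn (@cosD2pi R) n.+1) subrK.
Qed.

Lemma riesz_factor_grid n k i x : (n <= k)%N ->
  riesz_factor k (x + grid n i) = riesz_factor k x.
Proof.
move=> nk; rewrite /riesz_factor circle_cos_periodic//.
have -> : (q ^ k)%N%:R * (i%:R / (q ^ n)%N%:R) = (q ^ (k - n) * i)%N%:R :> R.
  by rewrite -{1}(subnK nk) expnD !natrM; field.
exact: intr_nat.
Qed.

Lemma riesz_prod_grid n m l i x : (n <= m)%N ->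
  riesz_prod m l (x + grid n i) = riesz_prod m l x.
Proof.
move=> nm; apply: eq_big_nat => k /andP[mk _].
by rewrite riesz_factor_grid// (leq_trans nm).
Qed.

Lemma riesz_factor_next n j (t : R) :
  riesz_factor n (to_circle t + grid n.+1 j) =
  1 + a * cos (2 * pi * ((q ^ n)%N%:R * t) + j%:R * (pi / q%:R *+ 2)).
Proof.
rewrite /riesz_factor /grid -to_circleD circle_cosE; congr (1 + a * cos _).
by rewrite expnSr natrM; field; rewrite (qn_neq0 n) pnatr_eq0 -lt0n q0.
Qed.

(* Splitting the grid of level [n + 1] along that of level [n], the last factor
   depends only on the position inside a coarse cell. *)
Lemma sum_grid_riesz_prod (p A : R) m n (x : T) : 0 <= A ->
  (forall t : R,
    \sum_(0 <= j < q) (1 + a * cos (t + j%:R * (pi / q%:R *+ 2))) `^ p <= A) ->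
  (m <= n)%N ->
  \sum_(0 <= i < q ^ n) riesz_prod m n (x + grid n i) `^ p
    <= (q ^ m)%N%:R * A ^+ (n - m).
Proof.
move=> A0 hA; elim: n x => [|n IH] x mn.
  move: mn; rewrite leqn0 => /eqP->.
  by rewrite subnn expr0 mulr1 expn0 big_nat1 /riesz_prod big_nil powR1.
move: mn; rewrite leq_eqVlt => /predU1P[->|mn].
  rewrite subnn expr0 mulr1; under eq_bigr do rewrite /riesz_prod big_geq// powR1.
  by rewrite big_const_nat subn0 iter_addr addr0.
have {}mn : (m <= n)%N by [].
rewrite expnSr sum_nat_mul exchange_big/=.
apply: (@le_trans _ _ (\sum_(0 <= j < q)
   riesz_factor n (x + grid n.+1 j) `^ p * ((q ^ m)%N%:R * A ^+ (n - m)))).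
  apply: ler_sum => j _.
  apply: le_trans (ler_wpM2l (powR_ge0 _ _) (IH (x + grid n.+1 j) mn)).
  rewrite big_distrr/=; apply: ler_sum => i _.
  rewrite gridS addrA /riesz_prod big_nat_recr//= powRM.
  - by rewrite (riesz_factor_grid i _ (leqnn n)) mulrC.
  - exact: riesz_prod_ge0.
  - exact: riesz_factor_ge0.
rewrite -mulr_suml subSn// exprS [leRHS]mulrCA; apply: ler_wpM2r.
  by rewrite mulr_ge0// exprn_ge0.
rewrite -[x]to_circle_repr; under eq_bigr do rewrite riesz_factor_next.
exact: hA.
Qed.

End grid.

(** * Topology of the circle and translation invariance of its Lebesgue measure *)

Lemma lebesgue_measure_shift (R : realType) (c : R) (A : set R) :
  measurable A ->
  lebesgue_measure ((fun t => t + c) @^-1` A) = lebesgue_measure A.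
Proof.
move=> mA; pose f (t : measurableTypeR R) : measurableTypeR R := t + c.
have mf : measurable_fun [set: measurableTypeR R] f.
  apply: continuous_measurable_fun => x.
  by apply: cvgD; [exact: cvg_id|exact: cvg_cst].
pose nu := measure_function_pushforward__canonical__measure_function_Measure
  (@lebesgue_measure R) mf.
apply/esym; have := @lebesgue_measure_unique R nu; apply => // _ [[x y] _ <-] /=.
rewrite /pushforward /f.
have -> : (fun t => t + c) @^-1` `]x, y] = `]x - c, y - c]%classic.
  by apply/seteqP; split => z /=; rewrite !in_itv/=; lra.
rewrite !lebesgue_measure_itv/= !lte_fin ltrBlDr subrK.
by case: ifPn => // _; rewrite -!EFinB; congr EFin; ring.
Qed.

Section circle_topology.
Context {R : realType}.
Local Notation T := (circle R).

Lemma circle_distE (u v : T) : mdist u v = circle_norm (u - v).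
Proof. by []. Qed.

(** A point close to [u] lifts to a real close to [repr u], so continuity can be tested on the
    line. *)
Lemma continuous_circle (U : topologicalType) (f : T -> U) :
  continuous (f \o @to_circle R) -> continuous f.
Proof.
move=> cf u A; rewrite -{1}[u]to_circle_repr => /cf.
move=> /nbhs_ballP[e /= e0 he]; apply/nbhs_ballP; exists e => //= v.
rewrite ballEmdist /= circle_distE => /circle_norm_lt[s su se].
have -> : v = to_circle (repr u - s).
  by rewrite to_circleD to_circleN su to_circle_repr opprB addrC subrK.
by apply: he; rewrite /= /ball/= opprB addrC subrK.
Qed.

Lemma measurable_continuous_circle (f : T -> R) :
  continuous f -> measurable_fun setT f.
Proof.
move=> /continuousP cf; apply: (measurability _ (RGenOpens.measurableE R)).
move=> _ [_ [x [y ->] <-]]; rewrite setTI; apply: sub_sigma_algebra.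
by apply: cf; exact: interval_open.
Qed.

Lemma continuous_circle_shift (c : T) : continuous (fun x : T => x + c).
Proof.
move=> u A /nbhs_ballP[e /= e0 he]; apply/nbhs_ballP; exists e => //= v.
rewrite ballEmdist /= => uv; apply: he; rewrite ballEmdist /=.
by rewrite circle_distE opprD addrACA subrr addr0.
Qed.

Lemma measurable_circle_shift (c : T) : measurable_fun setT (fun x : T => x + c).
Proof.
apply: measurability; first by [].
move=> _ [U oU <-]; rewrite setTI; apply: sub_sigma_algebra.
by move/continuousP: (@continuous_circle_shift c); exact.
Qed.

Lemma to_circle_int (x : R) : x \is a Num.int -> to_circle x = 0.
Proof. by move=> xint; rewrite -to_circle0; apply/to_circleP; rewrite subr0. Qed.

Lemma circle_reprP (u : T) : exists2 t : R, to_circle t = u & 0 <= t < 1.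
Proof.
exists (repr u - (Num.floor (repr u))%:~R).
  rewrite to_circleD to_circleN (to_circle_int (intr_int _ _)) subr0.
  exact: to_circle_repr.
have := floor_le (repr u); have := floorD1_gt (repr u).
by rewrite intrD; lra.
Qed.

Lemma circle_lebesgueE (A : set T) :
  circle_lebesgue A = lebesgue_measure ((@to_circle R) @^-1` A `&` `[0, 1[).
Proof. by []. Qed.

Lemma circle_lebesgue_shift (c : T) (A : set T) : measurable A ->
  circle_lebesgue ((fun x => x + c) @^-1` A) = circle_lebesgue A.
Proof.
move=> mA; have [r <- /andP[r0 r1]] := circle_reprP c.
rewrite !circle_lebesgueE; set B := (@to_circle R) @^-1` A.
have mB : measurable B.
  by rewrite -[B]setTI; exact: measurable_to_circle.
have B1 t : B (t - 1) = B t.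
  rewrite /B /= to_circleD to_circleN (@to_circle_int 1) ?subr0//.
(* The fundamental domain is cut at [1 - r]: the left piece is translated onto [[r, 1[], the right
   one, after subtracting 1, onto [[0, r[]. *)
have -> : (@to_circle R) @^-1` ((fun x => x + to_circle r) @^-1` A) `&` `[0, 1[
    = (fun t => t + r) @^-1` (B `&` `[r, 1[)
      `|` (fun t => t + (r - 1)) @^-1` (B `&` `[0, r[).
  apply/seteqP; split => t /=; rewrite !in_itv/= -!to_circleD -/(B (t + r)).
    move=> [Bt /andP[t0 t1]]; have [tr|tr] := ltP (t + r) 1.
      by left; split=> //; apply/andP; split; lra.
    by right; rewrite addrA -/(B (t + r - 1)) B1; split=> //; apply/andP; split; lra.
  case=> -[]; first by move=> Bt /andP[? ?]; split => //; apply/andP; split; lra.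
  rewrite addrA -/(B (t + r - 1)) B1 => Bt /andP[? ?].
  by split => //; apply/andP; split; lra.
have mshift (s : R) (C : set R) :
    measurable C -> measurable ((fun t => t + s) @^-1` C).
  move=> mC; rewrite -[X in measurable X]setTI.
  apply: continuous_measurable_fun => // x.
  by apply: cvgD; [exact: cvg_id|exact: cvg_cst].
have m1 : measurable (B `&` `[r, 1[) by apply: measurableI.
have m2 : measurable (B `&` `[0, r[) by apply: measurableI.
rewrite measureU; [|exact: mshift|exact: mshift|]; last first.
  apply/seteqP; split => t //= [] [_ +] [_ +].
  by rewrite !in_itv/= => /andP[? ?] /andP[? ?]; lra.
transitivity (lebesgue_measure (B `&` `[r, 1%R[) +
              lebesgue_measure (B `&` `[0%R, r[))%E.
  by congr (_ + _)%E; exact: lebesgue_measure_shift.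
rewrite -measureU//; last first.
  apply/seteqP; split => t //= [] [_ +] [_ +].
  by rewrite !in_itv/= => /andP[? ?] /andP[? ?]; lra.
congr lebesgue_measure; rewrite -setIUr; congr (B `&` _).
apply/seteqP; split => t /=; rewrite !in_itv/=.
  by case=> /andP[? ?]; apply/andP; split; lra.
move=> /andP[? ?]; have [tr|tr] := ltP t r; [right|left];
  by apply/andP; split; lra.
Qed.

Lemma circle_lebesgueT : circle_lebesgue [set: T] = 1%E.
Proof.
rewrite circle_lebesgueE preimage_setT setTI lebesgue_measure_itv/=.
by rewrite lte_fin ltr01 oppr0 adde0.
Qed.

Lemma integral_circle_shift (c : T) (f : T -> R) : measurable_fun setT f ->
  (forall x, 0 <= f x) ->
  (\int[@circle_lebesgue R]_x (f (x + c))%:E =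
   \int[@circle_lebesgue R]_x (f x)%:E)%E.
Proof.
move=> mf f0; have mc := @measurable_circle_shift c.
pose sh (x : T) : T := x + c.
transitivity (\int[pushforward (@circle_lebesgue R) sh]_x (f x)%:E)%E.
  rewrite [RHS]ge0_integral_pushforward//; first exact/measurable_EFinP.
  by move=> y _; rewrite lee_fin.
by apply: eq_measure_integral => A mA _; exact: circle_lebesgue_shift.
Qed.

End circle_topology.

(** * Integrals against the Riesz product *)

Section riesz_integral.
Context {R : realType} (q : nat) (q3 : (3 <= q)%N) (a : R) (a1 : -1 <= a <= 1).
Local Notation T := (circle R).
Local Notation leb := (@circle_lebesgue R).

Let q0 : (0 < q)%N. Proof. exact: leq_trans q3. Qed.

Lemma continuous_riesz_factor k : continuous (riesz_factor q a k).
Proof.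
apply: continuous_circle => t /=.
rewrite (_ : _ \o _ =
    fun t => 1 + a * cos (2 * pi * ((q ^ k)%N%:R * t))); last first.
  by apply/funext => s /=; rewrite /riesz_factor circle_cosE.
apply: cvgD; first exact: cvg_cst.
apply: cvgM; first exact: cvg_cst.
apply: (@cvg_comp _ _ _ (fun t : R => 2 * pi * ((q ^ k)%N%:R * t)) cos).
  by do 2 (apply: cvgM; first exact: cvg_cst); exact: cvg_id.
exact: continuous_cos.
Qed.

Lemma continuous_riesz_prod m n : continuous (riesz_prod q a m n).
Proof.
apply: continuous_big; first exact: mul_continuous.
by move=> i _; exact: continuous_riesz_factor.
Qed.

Lemma measurable_riesz_prod m n : measurable_fun setT (riesz_prod q a m n).
Proof. by apply: measurable_continuous_circle; exact: continuous_riesz_prod. Qed.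

(** Translation invariance allows [g] to be replaced by its average over the grid translates, which
    leave [h] fixed. *)
Lemma integral_grid_average n (g h : T -> R) (M : R) :
  measurable_fun setT g -> measurable_fun setT h ->
  (forall x, 0 <= g x) -> (forall x, 0 <= h x) -> 0 <= M ->
  (forall i x, h (x + grid q n i) = h x) ->
  (forall x, \sum_(0 <= i < q ^ n) g (x + grid q n i) <= (q ^ n)%N%:R * M) ->
  (\int[leb]_x (g x * h x)%:E <= M%:E * \int[leb]_x (h x)%:E)%E.
Proof.
move=> mg mh g0 h0 M0 hper gle.
have N0 : 0 < (q ^ n)%N%:R :> R by rewrite ltr0n expn_gt0 q0.
have mgh : measurable_fun setT (fun x => g x * h x) by exact: measurable_funM.
have gh0 x : 0 <= g x * h x by exact: mulr_ge0.
have mgi i : measurable_fun setT (fun x : T => g (x + grid q n i)).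
  by apply: measurableT_comp mg _; exact: measurable_circle_shift.
rewrite -(@lee_pmul2l _ (q ^ n)%N%:R%:E)//.
have -> : ((q ^ n)%N%:R%:E * \int[leb]_x (g x * h x)%:E =
  \int[leb]_x (\sum_(0 <= i < q ^ n) (g (x + grid q n i)%R * h x)%:E))%E.
  rewrite ge0_integral_sum//; last 2 first.
  - by move=> i; apply/measurable_EFinP; exact: measurable_funM.
  - by move=> i x _; rewrite lee_fin mulr_ge0.
  transitivity (\sum_(0 <= i < q ^ n) \int[leb]_x (g x * h x)%:E)%E.
    elim: (q ^ n)%N => [|k IH]; first by rewrite big_nil mul0e.
    by rewrite big_nat_recr//= -IH -natr1 EFinD ge0_muleDl ?mul1e// lee_fin.
  apply: eq_bigr => i _; rewrite -(@integral_circle_shift _ (grid q n i) _ mgh gh0).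
  by apply: eq_integral => x _; rewrite hper.
rewrite muleA -EFinM -ge0_integralZl_EFin//; last 3 first.
- by move=> x _; rewrite lee_fin.
- exact/measurable_EFinP.
- by rewrite mulr_ge0// ltW.
apply: ge0_le_integral => //.
- by move=> x _; rewrite sumEFin lee_fin sumr_ge0// => i _; rewrite mulr_ge0.
- under eq_fun do rewrite sumEFin; apply/measurable_EFinP.
  by apply: measurable_sum => i; exact: measurable_funM.
- by apply/measurable_EFinP; exact: measurable_funM.
- by move=> x _; rewrite sumEFin -EFinM lee_fin -mulr_suml ler_wpM2r.
Qed.

(** This is the grid moment bound at exponent 1, where each one-step sum is exactly [q]. *)
Lemma integral_riesz_prod_le1 m n : (m <= n)%N ->
  (\int[leb]_x (riesz_prod q a m n x)%:E <= 1)%E.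
Proof.
move=> mn; have h1 : (\int[leb]_x (cst (1 : R) x)%:E = 1)%E.
  by rewrite -[LHS]/(\int[leb]_x cst 1 x)%E integral_cst//= circle_lebesgueT mule1.
have -> : (\int[leb]_x (riesz_prod q a m n x)%:E =
           \int[leb]_x (riesz_prod q a m n x * cst 1 x)%:E)%E.
  by apply: eq_integral => x _; rewrite mulr1.
rewrite -[leRHS]mule1 -{2}h1; apply: (@integral_grid_average n) => //.
- exact: measurable_riesz_prod.
- by move=> x; exact: riesz_prod_ge0.
- move=> x; have := @sum_grid_riesz_prod R q q0 a a1 1 q%:R m n x (ler0n _ _) _ mn.
  rewrite mulr1 -natrX -natrM -expnD subnKC//.
  under eq_bigr do rewrite powRr1 ?riesz_prod_ge0//; apply => t.
  rewrite (eq_bigr (fun j => 1 + a * cos (t + j%:R * (pi / q%:R *+ 2)))).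
    by rewrite sum_affine_cos.
  move=> j _; rewrite powRr1//.
  have : `|a * cos (t + j%:R * (pi / q%:R *+ 2))| <= 1.
    by rewrite normrM -[1]mulr1 ler_pM ?ler_norml// cos_geN1 cos_le1.
  by rewrite ler_norml; lra.
Qed.

(** The density of index [N] splits at level [n]; its tail is invariant under the grid of level [n]
    and has integral at most 1. The resulting bound is uniform in [N] and survives the weak
    limit. *)
Lemma riesz_product_integral_le (mu : set T -> \bar R) n (f : T -> R) (M : R) :
  is_riesz_product a q mu -> continuous f -> (forall x, 0 <= f x) -> 0 <= M ->
  (forall x, \sum_(0 <= i < q ^ n)
     f (x + grid q n i) * riesz_prod q a 0 n (x + grid q n i)
       <= (q ^ n)%N%:R * M) ->
  (\int[mu]_x (f x)%:E <= M%:E)%E.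
Proof.
move=> muP cf f0 M0 fM; have := muP _ cf => fmu.
rewrite -(cvg_lim _ fmu)//; apply: lime_le.
  by apply/cvg_ex; eexists; exact: fmu.
near=> N; have nN : (n <= N.+1)%N by apply: leqW; near: N; exact: nbhs_infty_ge.
have dens x :
    riesz_density a q N x = riesz_prod q a 0 n x * riesz_prod q a n N.+1 x.
  by rewrite riesz_densityE /riesz_prod -big_cat_nat.
under eq_integral do rewrite dens mulrA.
have mf := measurable_continuous_circle cf.
apply: (@le_trans _ _ (M%:E * \int[leb]_x (riesz_prod q a n N.+1 x)%:E)%E).
  apply: (@integral_grid_average n) => //.
  - by apply: measurable_funM => //; exact: measurable_riesz_prod.
  - exact: measurable_riesz_prod.
  - by move=> x; rewrite mulr_ge0//; exact: riesz_prod_ge0.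
  - by move=> x; exact: riesz_prod_ge0.
  - by move=> i x; rewrite riesz_prod_grid.
rewrite -[leRHS]mule1; apply: lee_wpmul2l; first by rewrite lee_fin.
exact: integral_riesz_prod_le1.
Unshelve. all: by end_near. Qed.

End riesz_integral.

(** Markov's inequality, used to pass from bump functions to sets. *)
Lemma measure_ge1_le (d : measure_display) (T : measurableType d)
    (R : realType) (mu : {measure set T -> \bar R}) (f : T -> R) :
  measurable_fun setT f -> (forall x, 0 <= f x) ->
  (mu [set x | (1 <= f x)%R] <= \int[mu]_x (f x)%:E)%E.
Proof.
move=> mf f0; set A := [set x | _].
have mA : measurable A.
  rewrite (_ : A = setT `&` f @^-1` `[1, +oo[); first exact: mf.
  by rewrite setTI; apply/seteqP; split => x; rewrite /A /= in_itv/= andbT.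
rewrite -[A in leLHS]setIT -integral_indic//; apply: ge0_le_integral => //.
- exact/measurable_EFinP.
- exact/measurable_EFinP.
- move=> x _; rewrite lee_fin indicE.
  by have [|//] := boolP (x \in A); rewrite inE.
Qed.

(** * Bump functions and their bounded overlap *)

Section bump.
Context {R : realType}.
Local Notation T := (circle R).

Lemma circle_norm_ge0 (x : T) : 0 <= circle_norm x.
Proof. by rewrite -[x]subr0 -circle_distE mdist_ge0. Qed.

Lemma circle_normN (x : T) : circle_norm (- x) = circle_norm x.
Proof. by rewrite -[x in RHS]subr0 -circle_distE metric_sym circle_distE sub0r. Qed.

Lemma circle_normD (x y : T) : circle_norm (x + y) <= circle_norm x + circle_norm y.
Proof.
have := @metric_triangle R T x 0 (- y).
by rewrite !circle_distE opprK subr0 add0r.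
Qed.

Lemma continuous_circle_norm : continuous (@circle_norm R).
Proof.
move=> u A /nbhs_ballP[e /= e0 he]; apply/nbhs_ballP; exists e => //= v.
rewrite ballEmdist /= circle_distE => uv; apply: he; rewrite /ball/=.
apply: le_lt_trans uv; rewrite ler_norml.
have := circle_normD (u - v) v; have := circle_normD (v - u) u.
by rewrite !subrK -(circle_normN (u - v)) opprB; lra.
Qed.

(* The constant 3 makes the bump at least 1 within [2 / N] of 0: a set of
   diameter [1 / N] lies that close to the grid point nearest to any of its
   points. *)
Definition bump (N : nat) (x : T) : R := Num.max 0 (3 - N%:R * circle_norm x).

Lemma bump_ge0 N x : 0 <= bump N x. Proof. by rewrite le_max lexx. Qed.

Lemma bump_le N x : bump N x <= 3.
Proof.
by rewrite ge_max ler0n/= gerBl mulr_ge0// circle_norm_ge0.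
Qed.

Lemma bumpN N x : bump N (- x) = bump N x.
Proof. by rewrite /bump circle_normN. Qed.

Lemma bump_ge1 N x : (0 < N)%N -> circle_norm x <= 2 / N%:R -> 1 <= bump N x.
Proof.
move=> N0; rewrite ler_pdivlMr ?ltr0n// mulrC => h.
by rewrite le_max; apply/orP; right; lra.
Qed.

Lemma bump_neq0 N x : (0 < N)%N -> bump N x != 0 -> circle_norm x < 3 / N%:R.
Proof.
move=> N0; apply: contraNT; rewrite -leNgt ler_pdivrMr ?ltr0n// mulrC => h.
by rewrite /bump max_l// subr_le0.
Qed.

Lemma continuous_bump N : continuous (bump N).
Proof.
move=> x.
apply: (@continuous_max R T (cst 0) (fun x => 3 - N%:R * circle_norm x) x).
  exact: (@cst_continuous T R).
apply: continuousB; first exact: (@cst_continuous T R).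
apply: continuousM; first exact: (@cst_continuous T R).
exact: continuous_circle_norm.
Qed.

Lemma continuous_bump_shift N c : continuous (fun x => bump N (x - c)).
Proof.
move=> x; apply: (@cvg_comp _ _ _ (fun x : T => x - c) (bump N)).
  exact: continuous_circle_shift.
exact: continuous_bump.
Qed.

Definition grid_near N (x : T) : {set 'I_N} :=
  [set k : 'I_N | circle_norm (x + to_circle (k%:R / N%:R)) < 3 / N%:R]%SET.

(* Real representatives [t] of the points [x + k / N] close to 0 differ by
   multiples of [1 / N], so that [k] can be read off [floor (N * t)]. *)
Lemma card_grid_near N (x : T) : (0 < N)%N ->
  (#|grid_near N x| <= 6)%N.
Proof.
move=> N0; have N0' : 0 < N%:R :> R by rewrite ltr0n.
set P := grid_near N x.
pose reps (k : 'I_N) : set R :=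
  [set t | to_circle t = x + to_circle (k%:R / N%:R) /\ `|t| < 3 / N%:R].
pose t k : R := xget 0 (reps k).
have tP k : k \in P -> reps k (t k).
  by rewrite inE => /circle_norm_lt[s s1 s2]; apply: xgetPex; exists s.
(* Since [N * t k] lies strictly between -3 and 3, its floor takes only the six values from -3 to 2,
   shifted here to start at 0. *)
pose f (k : 'I_N) : 'I_6 := inord (absz (Num.floor (N%:R * t k) + 3)).
rewrite -[6%N]card_ord; apply: (@leq_card_in _ _ f) => k l kP lP.
have bnd j : j \in P -> (- 3 <= Num.floor (N%:R * t j) < 3)%R.
  move=> /tP[_]; rewrite ltr_norml => /andP[]; rewrite -mulNr.
  rewrite ltr_pdivrMr// ltr_pdivlMr// => h1 h2.
  rewrite floor_ge_int floor_lt_int; apply/andP; split.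
    by rewrite mulrNz; lra.
  by rewrite mulrC.
have /andP[k1 k2] := bnd _ kP; have /andP[l1 l2] := bnd _ lP.
move=> /(congr1 val) /=; rewrite !inordK; [|lia|lia] => fkl.
have {}fkl : Num.floor (N%:R * t k) = Num.floor (N%:R * t l) by lia.
have [tk _] := tP _ kP; have [tl _] := tP _ lP.
have /to_circleP/intrP[z hz] :
    to_circle (t k - k%:R / N%:R) = to_circle (t l - l%:R / N%:R).
  by rewrite !to_circleD !to_circleN tk tl !addrK.
have e : N%:R * t k - N%:R * t l = (k%:Z - l%:Z + N%:Z * z)%:~R :> R.
  rewrite !rmorphD/= rmorphN rmorphM/= -!pmulrn -hz; field; rewrite gt_eqF//.
(* Two reals with the same floor differ by less than 1, and this difference is an integer, hence 0.
   Then [k - l] is a multiple of [N] smaller than [N] in absolute value. *)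
have kl : k%:Z - l%:Z + N%:Z * z = 0.
  apply/eqP; rewrite -absz_eq0 -leqn0 -ltnS -ltz_nat -(ltr_int R) abszE.
  rewrite intr_norm -e.
  rewrite ltr_norml.
  have := floor_le (N%:R * t k); have := floorD1_gt (N%:R * t k).
  have := floor_le (N%:R * t l); have := floorD1_gt (N%:R * t l).
  by rewrite fkl intrD; lra.
apply/val_inj => /=; have := ltn_ord k; have := ltn_ord l.
have [z0|z0|z0] := ltrgtP z 0; last by lia.
  have : N%:Z * z <= - N%:Z by rewrite -mulrN1 ler_wpM2l//; lia.
  by lia.
have : N%:Z <= N%:Z * z by rewrite -[leLHS]mulr1 ler_wpM2l//; lia.
by lia.
Qed.

(** At most 6 translates are within reach of the bump, each contributing at most 3. *)
Lemma sum_bump_le N (x : T) : (0 < N)%N ->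
  \sum_(0 <= k < N) bump N (x + to_circle (k%:R / N%:R)) <= 18.
Proof.
move=> N0; rewrite big_mkord.
rewrite (bigID (mem (grid_near N x)))/=.
rewrite [X in _ + X]big1 ?addr0; last first.
  move=> k; rewrite inE => kx; apply/eqP; apply: contraNT kx.
  exact: bump_neq0.
apply: (@le_trans _ _ (\sum_(k in grid_near N x) 3)).
  by apply: ler_sum => k _; exact: bump_le.
rewrite sumr_const -[leLHS]mulr_natl -[18]/(18%N%:R).
have : (3 * #|grid_near N x| <= 18)%N.
  by have := card_grid_near x N0; lia.
by rewrite -(ler_nat R) natrM mulrC.
Qed.

End bump.

Lemma powR_natX (R : realType) (q n : nat) (y : R) :
  (q ^ n)%N%:R `^ y = (q%:R `^ y) ^+ n.
Proof.
rewrite natrX -(powR_mulrn n (powR_ge0 _ _)) -(powR_mulrn n (ler0n _ _)).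
exact: powRAC.
Qed.

(** Truncation at level [l]: where [u] exceeds [l], the power [p - 1] of [u / l] is at least 1. *)
Lemma ler_powR_split (R : realType) (p u l : R) : 1 <= p -> 0 <= u -> 0 < l ->
  u <= l + l `^ (1 - p) * u `^ p.
Proof.
move=> p1 u0 l0; have p0 : 0 < p by exact: lt_le_trans p1.
have [ul|lu] := leP u l; first by rewrite (le_trans ul)// lerDl mulr_ge0 ?powR_ge0.
apply: (@le_trans _ _ (l `^ (1 - p) * u `^ p)); last by rewrite lerDr ltW.
have lp : 0 < l `^ (p - 1) by exact: powR_gt0.
rewrite -(mulr_powRB1 u0 p0) -opprB powRN mulrCA -[leLHS]mulr1 ler_wpM2l//.
rewrite mulrC ler_pdivlMr// mul1r ge0_ler_powR ?nnegrE ?subr_ge0//; exact: ltW.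
Qed.

(** * Heavy arcs: their number and the decay of their mass *)

Section heavy_arcs.
Context {R : realType} (q : nat) (q3 : (3 <= q)%N).
Local Notation T := (circle R).
Context (mu : {finite_measure set T -> \bar R}) (s : R).

Let q0 : (0 < q)%N. Proof. exact: leq_trans q3. Qed.
Let qn0 n : (0 < q ^ n)%N. Proof. by rewrite expn_gt0 q0. Qed.
Let qnR0 n : 0 < (q ^ n)%N%:R :> R. Proof. by rewrite ltr0n. Qed.

Definition arc_bump n i (x : T) : R := bump (q ^ n) (x - grid q n i).

Definition arc_mass n i : \bar R := (\int[mu]_x (arc_bump n i x)%:E)%E.

Definition heavy_arcs n : seq nat :=
  [seq i <- index_iota 0 (q ^ n) |
    (((q ^ n)%N%:R `^ (- s))%:E < arc_mass n i)%E].

(** A continuous substitute for the indicator of the union of the heavy arcs, because the Riesz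
    product is given through continuous test functions. *)
Definition heavy_bump n (x : T) : R := \sum_(i <- heavy_arcs n) arc_bump n i x.

Definition heavy_set n : set T := [set x | 1 <= heavy_bump n x].

Lemma continuous_arc_bump n i : continuous (arc_bump n i).
Proof. exact: continuous_bump_shift. Qed.

Lemma continuous_heavy_bump n : continuous (heavy_bump n).
Proof.
apply: continuous_big; first exact: add_continuous.
by move=> i _; exact: continuous_arc_bump.
Qed.

Lemma arc_bump_ge0 n i x : 0 <= arc_bump n i x.
Proof. exact: bump_ge0. Qed.

Lemma heavy_bump_ge0 n x : 0 <= heavy_bump n x.
Proof. by apply: sumr_ge0 => i _; exact: arc_bump_ge0. Qed.

Lemma heavy_bump_le n x : heavy_bump n x <= 18.
Proof.
apply: (@le_trans _ _ (\sum_(0 <= i < q ^ n) arc_bump n i x)).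
  rewrite /heavy_bump /heavy_arcs big_filter [leRHS](bigID
    (fun i => ((q ^ n)%N%:R `^ (- s))%:E < arc_mass n i)%E)/=.
  by rewrite lerDl sumr_ge0// => i _; exact: arc_bump_ge0.
rewrite (eq_bigr (fun i => bump (q ^ n) (- x + grid q n i))).
  exact: sum_bump_le.
by move=> i _; rewrite /arc_bump -bumpN opprB addrC.
Qed.

Lemma measurable_arc_bump n i : measurable_fun setT (arc_bump n i).
Proof. by apply: measurable_continuous_circle; exact: continuous_arc_bump. Qed.

Lemma measurable_heavy_bump n : measurable_fun setT (heavy_bump n).
Proof. by apply: measurable_continuous_circle; exact: continuous_heavy_bump. Qed.

(** Double counting: every heavy arc carries mass above the threshold, while the bumps overlap with
    total height at most 18. *)
Lemma size_heavy_arcs n :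
  (size (heavy_arcs n))%:R * (q ^ n)%N%:R `^ (- s) <= 18 * fine (mu setT).
Proof.
have fmu : mu setT \is a fin_num by exact: fin_num_measure.
rewrite -lee_fin [leRHS]EFinM fineK//.
apply: (@le_trans _ _ (\sum_(i <- heavy_arcs n) arc_mass n i)%E).
  have -> : ((size (heavy_arcs n))%:R * ((q ^ n)%N%:R `^ (- s)))%:E =
     (\sum_(i <- heavy_arcs n) ((q ^ n)%N%:R `^ (- s))%:E)%E.
    by rewrite sumEFin big_const_seq count_predT iter_addr addr0 mulr_natl.
  rewrite big_seq [leRHS]big_seq; apply: lee_sum => i.
  by rewrite mem_filter => /andP[/ltW].
have -> : (\sum_(i <- heavy_arcs n) arc_mass n i =
           \int[mu]_x (heavy_bump n x)%:E)%E.
  rewrite -ge0_integral_sum//.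
  - by apply: eq_integral => x _; rewrite sumEFin.
  - by move=> i; apply/measurable_EFinP; exact: measurable_arc_bump.
  - by move=> i x _; rewrite lee_fin arc_bump_ge0.
rewrite -integral_cst//; apply: ge0_le_integral => //.
- by move=> x _; rewrite lee_fin heavy_bump_ge0.
- by apply/measurable_EFinP; exact: measurable_heavy_bump.
- by move=> x _; rewrite lee_fin heavy_bump_le.
Qed.

Section riesz.
Context (a : R) (a1 : -1 <= a <= 1) (muP : is_riesz_product a q mu).
Context (p A : R) (p1 : 1 <= p) (A0 : 0 <= A).
Context (hA : forall t : R,
  \sum_(0 <= j < q) (1 + a * cos (t + j%:R * (pi / q%:R *+ 2))) `^ p <= A).

(** The product is truncated at [l] on each grid. The low part sees only the number of heavy arcs,
    each met by the grid with total weight at most 18; the high part is controlled by the [p]-th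
    moment, the heavy bump being at most 18. *)
Lemma integral_heavy_bump_le n (l : R) : 0 < l ->
  (\int[mu]_x (heavy_bump n x)%:E <=
   (18 * (l * (size (heavy_arcs n))%:R + l `^ (1 - p) * A ^+ n)
      / (q ^ n)%N%:R)%:E)%E.
Proof.
move=> l0; apply: (riesz_product_integral_le q3 a1 (n := n) muP) => //.
- exact: continuous_heavy_bump.
- exact: heavy_bump_ge0.
- rewrite divr_ge0// ?ler0n// mulr_ge0// addr_ge0//.
    by rewrite mulr_ge0// ltW.
  by rewrite mulr_ge0 ?powR_ge0// exprn_ge0.
move=> x; rewrite mulrC divfK ?gt_eqF//.
set P := riesz_prod q a 0 n.
apply: (@le_trans _ _ (\sum_(0 <= k < q ^ n)
    (l * heavy_bump n (x + grid q n k) +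
     18 * (l `^ (1 - p) * P (x + grid q n k) `^ p)))).
  apply: ler_sum => k _.
  have P0 : 0 <= P (x + grid q n k) by exact: riesz_prod_ge0.
  apply: le_trans (ler_wpM2l (heavy_bump_ge0 _ _) (ler_powR_split p1 P0 l0)) _.
  rewrite mulrDr mulrC lerD2l ler_wpM2r ?heavy_bump_le//.
  by rewrite mulr_ge0 ?powR_ge0.
rewrite big_split/= -!big_distrr/= mulrDr lerD//.
  rewrite mulrCA ler_wpM2l//; first exact: ltW.
  rewrite exchange_big/=.
  apply: (@le_trans _ _ (\sum_(i <- heavy_arcs n) 18)); last first.
    by rewrite big_const_seq count_predT iter_addr addr0 mulr_natr.
  apply: ler_sum => i _.
  rewrite (eq_bigr (fun k => bump (q ^ n) (x - grid q n i + grid q n k))).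
    exact: sum_bump_le.
  by move=> k _; rewrite /arc_bump addrAC.
rewrite ler_wpM2l// ler_wpM2l ?powR_ge0//.
have := @sum_grid_riesz_prod R q q0 a a1 p A 0 n x A0 hA (leq0n n).
by rewrite expn0 mul1r subn0.
Qed.

Lemma heavy_set_decay (t : R) : t + s < 1 ->
  A < q%:R * q%:R `^ (t * (p - 1)) ->
  exists C r : R, [/\ 0 <= C, 0 <= r < 1 &
    forall n, (mu (heavy_set n) <= (C * r ^+ n)%:E)%E].
Proof.
move=> ts Aq; have qR0 : 0 < q%:R :> R by rewrite ltr0n.
have qR1 : 1 < q%:R :> R by rewrite ltr1n; exact: leq_trans q3.
set m := fine (mu setT).
have m0 : 0 <= m by rewrite fine_ge0.
(* With the truncation level [l] equal to [q ^ n] to the power [t], the two terms of the previous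
   bound are at most constant multiples of the [n]-th powers of [r1] and [r2]. *)
pose r1 := q%:R `^ (t + s - 1); pose r2 := q%:R `^ (t * (1 - p)) * A / q%:R.
have r10 : 0 <= r1 by exact: powR_ge0.
have r11 : r1 < 1.
  by rewrite /r1 /powR gt_eqF// expR_lt1 nmulr_rlt0 ?ln_gt0//; lra.
have r20 : 0 <= r2 by rewrite divr_ge0 ?mulr_ge0 ?powR_ge0// ltW.
have r21 : r2 < 1.
  rewrite /r2 ltr_pdivrMr// mul1r -opprB mulrN powRN.
  by rewrite mulrC ltr_pdivrMr ?powR_gt0.
pose r := Num.max r1 r2.
exists (18 * (18 * m + 1)), r; split.
- by rewrite mulr_ge0// addr_ge0// mulr_ge0.
- by rewrite le_max r10 gt_max r11 r21.
move=> n.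
apply: le_trans
  (measure_ge1_le mu (@measurable_heavy_bump n) (@heavy_bump_ge0 n)) _.
have l0 : 0 < (q ^ n)%N%:R `^ t :> R by rewrite powR_gt0.
apply: le_trans (integral_heavy_bump_le n l0) _.
rewrite lee_fin -!mulrA ler_wpM2l// mulrDl mulrDl mul1r lerD//.
  apply: (@le_trans _ _ (18 * m * r1 ^+ n)); last first.
    by rewrite ler_wpM2l ?mulr_ge0// lerXn2r ?nnegrE// le_max ?lexx// r10.
  rewrite /r1 -powR_natX.
  have -> : (q ^ n)%N%:R `^ (t + s - 1) =
    (q ^ n)%N%:R `^ t * (q ^ n)%N%:R `^ s / (q ^ n)%N%:R :> R.
    have N0 : (q ^ n)%N%:R != 0 :> R by rewrite gt_eqF.
    by rewrite !powRD ?N0 ?implybT// powRN powRr1// ltW.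
  rewrite mulrA ler_pM2r ?invr_gt0// mulrCA ler_pM2l//.
  have := size_heavy_arcs n; rewrite powRN ler_pdivrMr ?powR_gt0//.
apply: (@le_trans _ _ (r2 ^+ n)); last first.
  by apply: lerXn2r; rewrite ?nnegrE// le_max ?lexx ?r20 orbT.
by rewrite /r2 !exprMn exprVn natrX -powR_natX powRrM natrX.
Qed.

End riesz.
End heavy_arcs.

Lemma exists_expr_lt (R : realType) (m : nat) (z x : R) : 0 <= z < 1 -> 0 < x ->
  exists2 n, (m <= n)%N & z ^+ n < x.
Proof.
move=> /andP[z0 z1] x0.
have /cvgrPdist_lt/(_ _ x0) zx : (fun n => z ^+ n) @ \oo --> (0 : R).
  by apply: cvg_expr; rewrite ger0_norm.
near \oo => n; exists n; first by near: n; exact: nbhs_infty_ge.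
suff : `|0 - z ^+ n| < x by rewrite sub0r normrN ger0_norm// exprn_ge0.
by near: n.
Unshelve. all: by end_near. Qed.

(** For [0 < d] the level [n] is the last one with [d <= 1 / q ^ n]; then [1 / q ^ n < q * d],
    whence the factor with base [q]. The slack [e] serves the case [d = 0 < s], where no level is
    last and a sufficiently fine one is taken. *)
Lemma exists_scale (R : realType) (q m : nat) (s d e : R) :
  (1 < q)%N -> 0 <= s -> 0 <= d <= (q ^ m)%N%:R^-1 -> 0 < e ->
  exists n, [/\ (m <= n)%N, d <= (q ^ n)%N%:R^-1 &
    (q ^ n)%N%:R `^ (- s) <= q%:R `^ s * d `^ s + e].
Proof.
move=> q1 s0 /andP[d0 dm] e0.
have q0 : 0 < q%:R :> R by rewrite ltr0n ltnW.
have qn0 n : 0 < (q ^ n)%N%:R :> R by rewrite ltr0n expn_gt0 ltnW.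
move: d0; rewrite le_eqVlt => /predU1P[d0|d0].
  (* For [s = 0] the convention that 0 to the power 0 is 1 makes level [m] suitable. *)
  move: s0; rewrite le_eqVlt => /predU1P[s0|s0].
    exists m; split=> //.
    by rewrite -s0 oppr0 !powRr0 mulr1 lerDl ltW.
  have [] := exists_expr_lt m (z := q%:R `^ (- s)) _ e0.
    rewrite powR_ge0/= /powR gt_eqF// expR_lt1 mulNr oppr_lt0 mulr_gt0//.
    by rewrite ln_gt0// ltr1n.
  move=> n mn ne; exists n; split=> //; first by rewrite -d0 invr_ge0 ltW.
  by rewrite -d0 powR0 ?gt_eqF// mulr0 add0r powR_natX ltW.
have exP : exists k, (q ^ k)%N%:R^-1 < d.
  have [] := exists_expr_lt 0 (z := q%:R^-1) _ d0.
    by rewrite invr_ge0 ltW//= invf_lt1// ltr1n.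
  by move=> n _ nd; exists n; rewrite natrX -exprVn.
have mk : (m < ex_minn exP)%N.
  case: ex_minnP => k kd _; rewrite ltnNge; apply/negP => km.
  suff : (q ^ m)%N%:R^-1 <= (q ^ k)%N%:R^-1 :> R by lra.
  by rewrite lef_pV2 ?posrE// ler_nat leq_pexp2l// ltnW.
move: mk; case: ex_minnP => -[//|n] nd nmin mn; exists n.
have dn : d <= (q ^ n)%N%:R^-1.
  by rewrite leNgt; apply/negP => /nmin; rewrite ltnn.
split=> //; apply: (@le_trans _ _ (q%:R `^ s * d `^ s)); last by rewrite lerDl ltW.
rewrite -powRM ?(ltW q0) ?(ltW d0)//.
have -> : (q ^ n)%N%:R `^ (- s) = (q ^ n)%N%:R^-1 `^ s :> R.
  by rewrite -powR_inv1 ?ltW// -powRrM mulN1r.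
apply: ge0_ler_powR => //.
- by rewrite nnegrE invr_ge0 ltW.
- by rewrite nnegrE mulr_ge0// ltW.
move: nd; rewrite expnS natrM invfM => nd.
by rewrite -ler_pdivrMl// ltW.
Qed.

(** * The mass distribution principle outside the heavy arcs *)

Section mass_distribution.
Context {R : realType} (q : nat) (q3 : (3 <= q)%N).
Local Notation T := (circle R).
Context (mu : {finite_measure set T -> \bar R}) (s : R) (s0 : 0 <= s).

Let q0 : (0 < q)%N. Proof. exact: leq_trans q3. Qed.
Let qn0 n : (0 < q ^ n)%N. Proof. by rewrite expn_gt0 q0. Qed.
Let qnR0 n : 0 < (q ^ n)%N%:R :> R. Proof. by rewrite ltr0n. Qed.

Lemma exists_grid_near n (x : T) :
  exists2 i, (i < q ^ n)%N & circle_norm (x - grid q n i) <= (q ^ n)%N%:R^-1.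
Proof.
have [t <- /andP[t0 t1]] := circle_reprP x.
have f0 : 0 <= Num.floor ((q ^ n)%N%:R * t) by rewrite floor_ge_int mulr_ge0.
exists (absz (Num.floor ((q ^ n)%N%:R * t))).
  rewrite -ltz_nat gez0_abs// floor_lt_int -pmulrn.
  by rewrite -[ltRHS]mulr1 ltr_pM2l.
rewrite /grid -to_circleN -to_circleD; apply: le_trans (circle_norm_le _) _.
rewrite pmulrn gez0_abs//.
have h1 := floor_le ((q ^ n)%N%:R * t); have h2 := floorD1_gt ((q ^ n)%N%:R * t).
set k := Num.floor _ in h1 h2 *.
have -> : t - k%:~R / (q ^ n)%N%:R = ((q ^ n)%N%:R * t - k%:~R) / (q ^ n)%N%:R.
  by field; rewrite gt_eqF.
rewrite normrM [X in _ * X]gtr0_norm ?invr_gt0// -[leRHS]mul1r ler_pM2r ?invr_gt0//.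
by move: h2; rewrite intrD ler_norml; lra.
Qed.

(** All of [U] lies within two mesh widths of the grid point nearest to [x], so the bump there is at
    least 1 on [U]. That arc is light, since otherwise [x] would be in the heavy set. The measurable
    [V] stands in for [U], which is arbitrary. *)
Lemma light_cover n (U : set T) (x : T) : U x -> ~ heavy_set q mu s n x ->
  (forall y, U y -> mdist y x <= (q ^ n)%N%:R^-1) ->
  exists V, [/\ measurable V, U `<=` V &
    (mu V <= ((q ^ n)%N%:R `^ (- s))%:E)%E].
Proof.
move=> Ux nx Ud; have [i iq xi] := exists_grid_near n x.
have bump1 y : U y -> 1 <= arc_bump q n i y.
  move=> Uy; apply: bump_ge1 => //; rewrite -[y](subrK x) -addrA.
  apply: le_trans (circle_normD _ _) _; rewrite mulr_natl mulr2n.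
  by apply: lerD => //; exact: Ud.
exists [set y | 1 <= arc_bump q n i y]; split=> //.
  rewrite (_ : mkset _ = setT `&` arc_bump q n i @^-1` `[1, +oo[).
    exact: measurable_arc_bump.
  by rewrite setTI; apply/seteqP; split => y; rewrite /= in_itv/= andbT.
apply: le_trans (measure_ge1_le mu
  (@measurable_arc_bump _ q n i) (@arc_bump_ge0 _ q n i)) _.
rewrite leNgt; apply/negP => hi; apply: nx.
have hin : i \in heavy_arcs q mu s n.
  by rewrite mem_filter mem_index_iota iq !andbT; exact: hi.
rewrite /heavy_set /= /heavy_bump (bigD1_seq i)//=; last first.
  by rewrite filter_uniq// iota_uniq.
rewrite -[leLHS]addr0 lerD ?bump1// sumr_ge0// => j _; exact: arc_bump_ge0.
Qed.

Lemma measurable_heavy_set n : measurable (heavy_set q mu s n).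
Proof.
rewrite (_ : heavy_set _ _ _ _ = setT `&` heavy_bump q mu s n @^-1` `[1, +oo[).
  exact: measurable_heavy_bump.
by rewrite setTI; apply/seteqP; split => y; rewrite /= in_itv/= andbT.
Qed.

Lemma diam_ub (U : set T) x y : U x -> U y -> ((mdist x y)%:E <= diam U)%E.
Proof. by move=> Ux Uy; apply: ereal_sup_ubound; exists x, y. Qed.

Lemma diam_pow_ge0 (U : set T) : (0 <= diam_pow s U)%E.
Proof. by rewrite /diam_pow; case: ifPn => // _; exact: poweR_ge0. Qed.

Lemma cover_le_diam_pow m (U F : set T) (e : R) : 0 < e ->
  (diam U <= ((q ^ m)%N%:R^-1)%:E)%E ->
  (forall n x, (m <= n)%N -> F x -> ~ heavy_set q mu s n x) ->
  exists V, [/\ measurable V, U `&` F `<=` V &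
    (mu V <= (q%:R `^ s)%:E * diam_pow s U + e%:E)%E].
Proof.
move=> e0 Um Fm; have [UF|/set0P[x [Ux Fx]]] := eqVneq (U `&` F) set0.
  exists set0; split; [by []|by rewrite UF|].
  rewrite measure0 adde_ge0 ?lee_fin ?(ltW e0)//.
  by rewrite mule_ge0 ?diam_pow_ge0// lee_fin powR_ge0.
(* The point [x] gives [0 <= diam U], which excludes the value [-oo] of the empty set. *)
have dx := diam_ub Ux Ux; rewrite mdistxx in dx.
have dfin : diam U \is a fin_num.
  by rewrite ge0_fin_numE//; apply: le_lt_trans Um _; rewrite ltry.
have dE : diam U = (fine (diam U))%:E by rewrite fineK.
have [] := @exists_scale R q m s (fine (diam U)) e (ltnW q3) s0 _ e0.
  by rewrite -!lee_fin -dE dx.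
move=> n [mn dn le].
have [] := @light_cover n U x Ux (Fm n x mn Fx).
  move=> y Uy; rewrite -lee_fin; apply: le_trans (diam_ub Uy Ux) _.
  by rewrite dE lee_fin.
move=> V [mV UV Vle]; exists V; split=> //; first by move=> y [/UV].
apply: (le_trans Vle); rewrite /diam_pow ifF; last first.
  by apply/negbTE/set0P; exists x.
by rewrite dE poweR_EFin -EFinM -EFinD lee_fin.
Qed.

Lemma measure_light_eq0 m (F : set T) : measurable F ->
  hausdorff_measure s F = 0%E ->
  (forall n x, (m <= n)%N -> F x -> ~ heavy_set q mu s n x) ->
  mu F = 0%E.
Proof.
move=> mF HF Fm; apply/eqP; rewrite eq_le measure_ge0 andbT.
apply/lee_addgt0Pr => e e0; rewrite add0e.
have k0 : 0 < q%:R `^ s + 1 :> R by rewrite ltr_wpDl// powR_ge0.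
(* The diameters will contribute at most [e'] times [q] to the power [s], and the slacks of the
   covering sets, summed geometrically, at most [e']: together [e]. *)
pose e' := e / (q%:R `^ s + 1); have e'0 : 0 < e' by exact: divr_gt0.
have : (hausdorff_premeasure s (q ^ m)%N%:R^-1 F < e'%:E)%E.
  apply: (@le_lt_trans _ _ 0%E); last by rewrite lte_fin.
  rewrite -HF; apply: ereal_sup_ubound; exists (q ^ m)%N%:R^-1 => //=.
  by rewrite invr_gt0.
move=> /ereal_inf_lt[_ [U [FU Ud] <-] Ue].
have ei i : 0 < e' / (2 ^ i.+1)%:R by rewrite divr_gt0// ltr0n expn_gt0.
have [V HV] := choice (fun i => cover_le_diam_pow (ei i) (Ud i) Fm).
have FV : F `<=` \bigcup_i V i.
  move=> x Fx; have [i _ Ux] := FU _ Fx; exists i => //.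
  by have [_ + _] := HV i; apply.
have mV i : measurable (V i) by have [] := HV i.
apply: le_trans (measure_sigma_subadditive mu mV mF FV) _.
apply: (@le_trans _ _ (\sum_(i <oo) ((q%:R `^ s)%:E * diam_pow s (U i) +
    (e' / (2 ^ i.+1)%:R)%:E))%E).
  by apply: lee_nneseries => // i _; have [] := HV i.
have dp0 i : (0 <= (q%:R `^ s)%:E * diam_pow s (U i))%E.
  by rewrite mule_ge0 ?diam_pow_ge0// lee_fin powR_ge0.
apply: le_trans (epsilon_trick _ dp0 (ltW e'0)) _.
rewrite nneseriesZl; last by move=> i _; exact: diam_pow_ge0.
have -> : e%:E = ((q%:R `^ s)%:E * e'%:E + e'%:E)%E.
  by rewrite -EFinM -EFinD; congr EFin; rewrite /e'; field; rewrite gt_eqF.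
by rewrite leeD2r// lee_wpmul2l ?lee_fin ?powR_ge0// ltW.
Qed.

(** A Borel-Cantelli argument: the part of [F] outside all heavy sets from level [m] on is null, and
    these heavy sets have total mass at most a geometric tail, which vanishes as [m] grows. *)
Lemma mass_distribution (C r : R) (F : set T) : 0 <= C -> 0 <= r < 1 ->
  (forall n, (mu (heavy_set q mu s n) <= (C * r ^+ n)%:E)%E) ->
  measurable F -> hausdorff_measure s F = 0%E -> mu F = 0%E.
Proof.
move=> C0 /andP[r0 r1] hdecay mF HF.
apply/eqP; rewrite eq_le measure_ge0 andbT.
have main m : (mu F <= (C / (1 - r) * r ^+ m)%:E)%E.
  pose G := \bigcup_n heavy_set q mu s (n + m).
  have mG : measurable G.
    by apply: bigcupT_measurable => n; exact: measurable_heavy_set.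
  have mFG : measurable (F `\` G) by exact: measurableD.
  have FG0 : mu (F `\` G) = 0%E.
    apply: (@measure_light_eq0 m) => //.
      (* Monotonicity of the Hausdorff measure: every cover of [F] also covers the smaller set. *)
      apply/eqP; rewrite eq_le; apply/andP; split.
        rewrite -HF; apply: ub_ereal_sup => _ [d d0 <-].
        apply: le_trans (ereal_sup_ubound _); last by exists d.
        apply: le_ereal_inf => _ [U [FU Ud] <-]; exists U => //; split=> //.
        by apply: subset_trans FU; exact: subDsetl.
      apply: le_trans (ereal_sup_ubound _); last by exists 1 => //=; exact: ltr01.
      apply: le_ereal_inf_tmp => _ [U _ <-].
      by apply: nneseries_ge0 => n _ _; exact: diam_pow_ge0.
    by move=> n x mn [Fx nGx] hx; apply: nGx; exists (n - m)%N => //; rewrite subnK.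
  apply: (@le_trans _ _ (mu G)).
    have -> : (mu F = mu (F `\` G) + mu (F `&` G))%E by exact: measureDI.
    rewrite FG0 add0e.
    by apply: le_measure; rewrite ?inE//; exact: measurableI.
  apply: le_trans (measure_sigma_subadditive mu _ mG (@subset_refl _ _)) _.
    by move=> n; exact: measurable_heavy_set.
  apply: lime_le; first by apply: is_cvg_nneseries => n _ _; exact: measure_ge0.
  apply: nearW => N.
  apply: (@le_trans _ _ (\sum_(0 <= n < N) (C * r ^+ (n + m))%:E)%E).
    by apply: lee_sum => n _; exact: hdecay.
  rewrite sumEFin lee_fin; under eq_bigr do rewrite exprD mulrA.
  rewrite -big_distrl/= -big_distrr/= big_mkord ler_wpM2r ?exprn_ge0// ler_wpM2l//.
  rewrite -[leRHS]mul1r ler_pdivlMr ?subr_gt0// mulrC -opprB mulNr -subrX1 opprB.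
  by rewrite gerBl exprn_ge0.
apply/lee_addgt0Pr => e e0; rewrite add0e.
have k0 : 0 <= C / (1 - r) by rewrite divr_ge0// subr_ge0 ltW.
have k1 : 0 < C / (1 - r) + 1 by rewrite ltr_wpDl.
have [|n _ rn] := exists_expr_lt 0 (z := r) _ (divr_gt0 e0 k1); first exact/andP.
apply: (le_trans (main n)); rewrite lee_fin.
move: rn; rewrite ltr_pdivlMr// => /ltW; apply: le_trans.
by rewrite mulrC ler_wpM2l ?exprn_ge0// lerDl.
Qed.

End mass_distribution.

Theorem theorem1p4 (R : realType) (q : nat) (a : R)
    (mu : {finite_measure set (circle R) -> \bar R}) :
  (3 <= q)%N -> -1 <= a <= 1 -> is_riesz_product a q mu ->
  ((1 - 1 / (q%:R * ln q%:R) *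
      \sum_(1 <= j < q.-1)
        (1 - cos ((2 * j + 1)%N%:R * pi / q%:R) / cos (pi / q%:R)) *
        ln (1 - cos ((2 * j + 1)%N%:R * pi / q%:R) / cos (pi / q%:R)))%:E
   <= lower_hausdorff_dim mu)%E.
Proof.
move=> q3 a1 muP.
set S := \sum_(1 <= j < q.-1) _.
have SE : S = \sum_(1 <= j < q.-1) vertex_coeff q j * ln (vertex_coeff q j) by [].
have qR0 : 0 < q%:R :> R by rewrite ltr0n; exact: leq_trans q3.
have lq0 : 0 < ln q%:R :> R by rewrite ln_gt0// ltr1n; exact: leq_trans q3.
apply: le_ereal_inf_tmp => _ [alpha [F [mF muF Fa]] <-].
rewrite leNgt; apply/negP => aD.
(* A set [F] of nonzero mass violating the bound has zero Hausdorff measure for some exponent [s]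
   still below the claimed value; it remains to show that [F] is null. *)
have /ereal_inf_lt[_ [s [s0 HF] <-]] := le_lt_trans Fa aD.
rewrite lte_fin => sD; move/eqP: muF; apply.
(* The midpoint of [h] and [1 - s]: [h < t] yields the exponent [p], and [t < 1 - s] the decay of
   the low part. *)
pose h := 1 / (q%:R * ln q%:R) * S; pose t := (h + (1 - s)) / 2.
have ht : h < t by rewrite /t; move: sD; rewrite -/h; lra.
have ts : t + s < 1 by rewrite /t; move: sD; rewrite -/h; lra.
have St : S < t * ln q%:R * q%:R.
  have -> : S = h * ln q%:R * q%:R by rewrite /h; field; rewrite !gt_eqF.
  by rewrite !ltr_pM2r.
(* The rate is [t * ln q] because [expR (t * ln q * (p - 1))] is the power of [q] with exponent
   [t * (p - 1)] that [heavy_set_decay] expects. *)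
have [|||p p1 Ap] := @exists_power_sum_lt R 1 q.-1 (vertex_coeff q) q%:R
  (t * ln q%:R) _ _ qR0 _.
- by move=> j; exact: vertex_coeff_gt0.
- by rewrite -(@sum_vertex _ _ q3 id)// sum_vertex_coeff.
- by rewrite -SE.
have A0 : 0 <= \sum_(1 <= j < q.-1) vertex_coeff q j `^ p :> R.
  by apply: sumr_ge0 => j _; exact: powR_ge0.
have [||C [r [C0 r01 hC]]] := heavy_set_decay q3 a1 muP (ltW p1) A0 _ ts.
- by move=> x; exact: sum_powR_cos_le (ltW p1) a1.
- by move: Ap; rewrite mulrAC /powR (gt_eqF qR0).
exact (mass_distribution q3 s0 C0 r01 hC mF HF).
Qed.
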